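(* Let $R$ be a $\sqrt{\Delta}$-fine ring. Then: (1) $R = \{1\} \cup \bigl(U(R) + U(R)\bigr)$, where $U(R)+U(R) = \{u+v : u,v \in U(R)\}$; (2) $R$ is $2$-good if and only if $|R| \neq 2$.
   Context: Rings are associative with identity, not necessarily commutative. For a ring $R$, $U(R)$ is its group of units. Define $\Delta(R) = \{a \in R : 1 - ua \in U(R) \text{ for every } u \in U(R)\}$ and $\sqrt{\Delta(R)} = \{x \in R : x^m \in \Delta(R) \text{ for some integer } m \ge 1\}$. A nonzero element $r \in R$ is called $\sqrt{\Delta}$-fine if $r = u + a$ for some $u \in U(R)$ and $a \in \sqrt{\Delta(R)}$. The ring $R$ is called $\sqrt{\Delta}$-fine if every nonzero element of $R$ is $\sqrt{\Delta}$-fine. A ring is $2$-good if each of its elements is a sum of two units. *)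

(* Defs.v *)
From mathcomp Require Import all_boot all_algebra.
From mathcomp Require Import boolp classical_sets functions cardinality.

Import GRing.Theory.
Local Open Scope classical_set_scope.
Local Open Scope ring_scope.

(* Rings are [pzRingType]: associative and unital, possibly noncommutative,
   and the zero ring is allowed.  The library's [GRing.unit] is only available
   for [unitRingType], which excludes the zero ring, so the group of units is
   defined here with two-sided inverses. *)
Definition ring_units (R : pzRingType) : set R :=
  [set u : R | exists v : R, u * v = 1 /\ v * u = 1].

Definition Delta (R : pzRingType) : set R :=
  [set a : R | forall u : R, ring_units R u -> ring_units R (1 - u * a)].

Definition sqrt_Delta (R : pzRingType) : set R :=
  [set x : R | exists m : nat, (1 <= m)%N /\ Delta R (x ^+ m)].

Definition sqrt_Delta_fine_element (R : pzRingType) (r : R) : Prop :=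
  r <> 0 /\
  exists u a : R, [/\ ring_units R u, sqrt_Delta R a & r = u + a].

Definition sqrt_Delta_fine (R : pzRingType) : Prop :=
  forall r : R, r <> 0 -> sqrt_Delta_fine_element R r.

Definition two_good (R : pzRingType) : Prop :=
  forall r : R, exists u v : R, [/\ ring_units R u, ring_units R v & r = u + v].

(* Main.v *)
(* If r <> 1, write r - 1 = u + a with u a unit and a^m in Delta.  Then
   r = u + (1 + a), and 1 + a is a unit because it divides, and commutes with,
   the unit 1 - (-a)^m.  The element 1 is a sum of two units as soon as some
   unit w differs from 1: decompose w^-1 and multiply by w.  If 1 were the only
   unit then 1 + 1 = 1 - 1 = 0, so every element of R would be 0 or 1. *)
Require Import Defs.
From mathcomp Require Import all_boot all_algebra.
From mathcomp Require Import boolp classical_sets functions cardinality.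

Local Open Scope classical_set_scope.
Local Open Scope card_scope.
Local Open Scope ring_scope.

Import GRing.Theory.

Lemma ring_units1 (R : pzRingType) : ring_units R 1.
Proof. by exists 1; rewrite mulr1. Qed.

Lemma ring_unitsN (R : pzRingType) (u : R) :
  ring_units R u -> ring_units R (- u).
Proof. by move=> [v [uv vu]]; exists (- v); rewrite !mulrNN. Qed.

Lemma ring_unitsM (R : pzRingType) (u v : R) :
  ring_units R u -> ring_units R v -> ring_units R (u * v).
Proof.
move=> [u' [uu' u'u]] [v' [vv' v'v]]; exists (v' * u'); split.
  by rewrite mulrA -(mulrA u) vv' mulr1.
by rewrite mulrA -(mulrA v') u'u mulr1.
Qed.

(** If [z] inverts [x * y], then [y * z] is a right inverse of [x] and, by commutation, [z * y] is a
    left inverse; the two must coincide. *)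
Lemma ring_units_comm_factor (R : pzRingType) (x y : R) :
  GRing.comm x y -> ring_units R (x * y) -> ring_units R x.
Proof.
move=> cxy [z [xyz zxy]].
have rightinv : x * (y * z) = 1 by rewrite mulrA.
have leftinv : z * y * x = 1 by rewrite -mulrA -cxy.
exists (y * z); split=> //.
by rewrite -[y * z]mul1r -leftinv -(mulrA (z * y)) rightinv mulr1.
Qed.

Lemma Delta_sub1 (R : pzRingType) (a : R) :
  Delta R a -> ring_units R (1 - a).
Proof. by move=> /(_ _ (ring_units1 R)); rewrite mul1r. Qed.

Lemma DeltaN (R : pzRingType) (a : R) : Delta R a -> Delta R (- a).
Proof. by move=> da u /ring_unitsN /da; rewrite mulNr mulrN. Qed.

Lemma sqrt_DeltaN (R : pzRingType) (a : R) :
  sqrt_Delta R a -> sqrt_Delta R (- a).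
Proof.
move=> [m [m_gt0 dam]]; exists m; split=> //.
rewrite exprNn -signr_odd; case: (odd m); last by rewrite mul1r.
by rewrite mulN1r; exact: DeltaN.
Qed.

Lemma sqrt_Delta_sub1 (R : pzRingType) (a : R) :
  sqrt_Delta R a -> ring_units R (1 - a).
Proof.
move=> [m [_ /Delta_sub1 uam]].
(* The cofactor of [1 - a] in [1 - a ^+ m] is the geometric sum, a polynomial in [a], hence it
   commutes with [1 - a]. *)
apply: (@ring_units_comm_factor _ _ (\sum_(i < m) a ^+ i)).
  apply: commr_sum => i _; apply/commr_sym/commrB; first exact: commr1.
  exact/commr_sym/commrX.
suff <- : 1 - a ^+ m = (1 - a) * \sum_(i < m) a ^+ i by [].
by rewrite -opprB subrX1 -mulNr opprB.
Qed.

Lemma sqrt_Delta_fine_sum_units (R : pzRingType) (r : R) :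
  sqrt_Delta_fine R -> r <> 1 ->
  exists u v : R, [/\ ring_units R u, ring_units R v & r = u + v].
Proof.
move=> hR r1; have /hR[_ [u [a [uu da ra]]]] : r - 1 <> 0.
  by move=> /subr0_eq.
exists u, (1 + a); split=> //.
  by rewrite -[a]opprK; exact/sqrt_Delta_sub1/sqrt_DeltaN.
by rewrite addrCA -ra addrC subrK.
Qed.

Lemma sqrt_Delta_fine_two_good (R : pzRingType) (w : R) :
  sqrt_Delta_fine R -> ring_units R w -> w <> 1 -> two_good R.
Proof.
move=> hR uw w1 r; have [->|/sqrt_Delta_fine_sum_units] := pselect (r = 1);
  last exact.
have [w' [ww' _]] := uw.
have /(sqrt_Delta_fine_sum_units _ _ hR)[u [v [uu uv w'E]]] : w' <> 1.
  by move=> w'1; apply: w1; rewrite -ww' w'1 mulr1.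
exists (w * u), (w * v); split; [exact: ring_unitsM.. |].
by rewrite -mulrDr -w'E.
Qed.

Lemma sqrt_Delta_fine_unit_neq1 (R : pzRingType) (r : R) :
  sqrt_Delta_fine R -> r <> 0 -> r <> 1 ->
  exists2 w : R, ring_units R w & w <> 1.
Proof.
move=> hR r0 r1; apply: contrapT => nw.
have unit1 w : ring_units R w -> w = 1.
  by move=> uw; apply: contrapT => w1; apply: nw; exists w.
have [u [v [/unit1 u1 /unit1 v1 rE]]] := sqrt_Delta_fine_sum_units _ _ hR r1.
(* As [- 1] is a unit, it equals [1]; the second summand of [1 + 1] is replaced by it. *)
apply: r0; rewrite rE u1 v1 -[X in _ + X](unit1 (- 1)) ?subrr //.
exact/ring_unitsN/ring_units1.
Qed.

(** Turns the cardinality condition into ring-theoretic terms: a ring with two elements is nonzero,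
    so these must be [0] and [1]. *)
Lemma card_eq_I2 (R : pzRingType) :
  [set: R] #= `I_2 <-> (1 : R) <> 0 /\ forall r : R, r = 0 \/ r = 1.
Proof.
split=> [/card_set_bijP[f [flt finj fsurj]] | [R10 R01]].
  have finjE x y : f x = f y -> x = y by apply: finj; rewrite in_setT.
  have f2 r : (f r < 2)%N by exact: flt.
  (* Otherwise the ring is zero, and [f] cannot reach both [0] and [1]. *)
  have f01 : f 0 <> f 1.
    move=> /finjE R01; have R0 (r : R) : r = 0 by rewrite -[r]mul1r -R01 mul0r.
    have [[x _ fx] [y _ fy]] := (fsurj 0%N isT, fsurj 1%N isT).
    by move: fx fy; rewrite (R0 x) (R0 y) => ->.
  split=> [R10|r]; first by rewrite R10 in f01.
  (* Pigeonhole: of three values below 2, two of which differ, the third repeats one of them. *)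
  suff [/finjE|/finjE] : f r = f 0 \/ f r = f 1 by [left|right].
  move: f01 (f2 0) (f2 1) (f2 r).
  by case: (f 0) (f 1) (f r) => [|[|?]] [|[|?]] [|[|?]] //; auto.
apply/card_set_bijP; exists (fun r : R => (r != 0) : nat); split.
- by move=> r _ /=; case: (r != 0).
- move=> r s _ _; case: (R01 r) => ->; case: (R01 s) => ->; rewrite ?eqxx //.
    by have /eqP/negPf-> := R10.
  by have /eqP/negPf-> := R10.
- case=> [|[|//]] _; first by exists 0; rewrite ?eqxx.
  by exists 1 => //; have /eqP-> := R10.
Qed.

Theorem theorem2p9 (R : pzRingType) (hR : sqrt_Delta_fine R) :
  [set: R] =
    [set 1] `|` [set u + v | u in ring_units R & v in ring_units R]
  /\ (two_good R <-> [set: R] #!= `I_2).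
Proof.
split.
  apply/seteqP; split=> // r _; have [->|r1] := pselect (r = 1); first by left.
  right; have [u [v [uu uv ->]]] := sqrt_Delta_fine_sum_units _ _ hR r1.
  by exists u => //; exists v.
split=> [good|card].
  (* With two elements, [1] is the only unit, so a decomposition of [1] would read [1 = 1 + 1]. *)
  apply/negP => /card_eq_I2[R10 R01].
  have unit1 w : ring_units R w -> w = 1.
    move=> [w' [ww' _]]; case: (R01 w) => // w0.
    by case: R10; rewrite -ww' w0 mul0r.
  have [u [v [/unit1-> /unit1-> one_eq]]] := good 1.
  apply: R10.
  by apply: (addrI 1); rewrite -one_eq addr0.
(* The zero ring does not have two elements, so it must be shown 2-good: all its elements are equal,
   and [1 + 1] represents each. *)
have [R10|R10] := pselect (1 = 0 :> R).
  move=> r; exists 1, 1; split; [exact: ring_units1..|].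
  by rewrite -[LHS]mul1r -[RHS]mul1r R10 !mul0r.
(* In a nonzero ring, not having exactly two elements forces a third one, which yields a unit other
   than [1]. *)
have [r [r0 r1]] : exists r : R, r <> 0 /\ r <> 1.
  apply: contrapT => nr; move/negP: card; apply; apply/card_eq_I2; split=> // r.
  have [->|r0] := pselect (r = 0); first by left.
  have [->|r1] := pselect (r = 1); first by right.
  by case: nr; exists r.
have [w uw w1] := sqrt_Delta_fine_unit_neq1 _ _ hR r0 r1.
exact: sqrt_Delta_fine_two_good uw w1.
Qed.
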